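(* Let $n,m,c$ be positive integers and take $\mathcal{G}=\mathbb{Z}$. Suppose $F:\mathbb{R}\to\mathbb{R}$ satisfies $F(z)=F(c-z)$ for all $z\in\mathbb{R}$, and $\mathrm{stat}:\mathrm{AV}_n\to\mathbb{Z}_{\geq 0}$ satisfies $\mathrm{stat}(g_0,g_1,\ldots,g_{n-1})=\sum_{0\leq i<j<n}F(g_i-g_j)$. For $k\in\{0,\ldots,n-1\}$ let $\mathrm{SKV}_k(t;\mathrm{stat})=\sum_{g\in\mathrm{SKV}_k}t^{\mathrm{stat}(g)}$. Then for all $k\in\{0,1,\ldots,n-1\}$, $\mathrm{SKV}_k(t;\mathrm{stat})=\mathrm{SKV}_{n-1}(t;\mathrm{stat})$, and this polynomial evaluated at $t=1$ equals $\frac{c}{(m+1)n+c}\binom{(m+1)n+c}{n}$.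
   Context: An area vector is $g=(g_0,\ldots,g_{n-1})\in\mathbb{Z}^n$ with $g_{i+1}\leq g_i+m$ for $0\leq i<n-1$; $\mathrm{AV}_n$ is the set of area vectors. For $k\in\{0,\ldots,n-1\}$, $g\in\mathrm{AV}_n$ is $k$-skeletal iff: (A0) $g_0\leq c$; (A1) $g_i>0$ for all $i\in\{n-k-1,\ldots,n-1\}$; (A2) there is no $i\in\{0,\ldots,n-k-1\}$ with $g_i,g_{i+1},\ldots,g_{i+k}$ all strictly greater than $c$. $\mathrm{SKV}_k$ is the (finite) set of $k$-skeletal area vectors. *)

(* Defs.v *)
From HB Require Import structures.
From mathcomp Require Import all_boot all_order all_algebra.
From mathcomp Require Import all_classical all_reals.
From mathcomp Require Import zify.

Set Implicit Arguments.
Unset Strict Implicit.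
Unset Printing Implicit Defensive.

Import Order.TTheory GRing.Theory Num.Theory.

Local Open Scope classical_set_scope.
Local Open Scope ring_scope.

Definition is_area_vector (n m : nat) (g : {ffun 'I_n -> int}) : bool :=
  [forall i : 'I_n, forall j : 'I_n,
     (j == i.+1 :> nat) ==> (g j <= g i + m%:Z)].

Definition AV (n m : nat) : Type :=
  {g : {ffun 'I_n -> int} | is_area_vector m g}.

HB.instance Definition _ n m := SubChoice.on (AV n m).

(* The index subtractions are truncated; they are only used for k < n. *)
Definition skeletal (n m c k : nat) (g : AV n m) : Prop :=
  [/\ forall i : 'I_n, i = 0%N :> nat -> val g i <= c%:Z,
      forall i : 'I_n, (n - k - 1 <= i)%N -> 0 < val g i
    & ~ exists2 i : 'I_n, (i <= n - k - 1)%N &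
        forall j : 'I_n, (i <= j <= i + k)%N -> c%:Z < val g j].

Definition SKV (n m c k : nat) : set (AV n m) := [set g | skeletal c k g].

Arguments SKV : clear implicits.

(* The sum over a classical set is 0 by convention when its support is
   infinite; SKV_finite below shows that this does not happen here. *)
Definition SKV_poly (n m c k : nat) (stat : AV n m -> nat) : {poly int} :=
  \sum_(g \in SKV n m c k) ('X^(stat g) : {poly int}).

Lemma SKV_finite (n m c k : nat) : finite_set (SKV n m c k).
Proof.
case: n => [|n].
  apply: (@sub_finite_set _ _ [set g : AV 0 m | True]) => //.
  have [[g0]|no] := pselect (inhabited (AV 0 m)).
    apply: (@sub_finite_set _ _ [set g0]) (finite_set1 g0) => g _ /=.
    by apply: val_inj; apply/ffunP => -[].
  apply: (@sub_finite_set _ _ set0) (finite_set0 _) => g _ /=.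
  by apply: no; split.
have step (g : AV n.+1 m) (i : nat) : (i < n)%N ->
    val g (inord i.+1) <= val g (inord i) + m%:Z.
  move=> lt_in; have /forallP/(_ (inord i))/forallP/(_ (inord i.+1)) := valP g.
  by rewrite !inordK ?eqxx //= ltnS ltnW.
have up (g : AV n.+1 m) (i : nat) : (i <= n)%N ->
    val g (inord i) <= val g (inord 0) + (m * i)%:Z.
  elim: i => [|i IHi] le_in; first by rewrite muln0 addr0.
  have := step g i le_in; have := IHi (ltnW le_in); lia.
have dn (g : AV n.+1 m) (d : nat) : (d <= n)%N ->
    val g (inord n) <= val g (inord (n - d)) + (m * d)%:Z.
  elim: d => [|d IHd] le_dn; first by rewrite subn0 muln0 addr0.
  have lt : (n - d.+1 < n)%N by lia.
  have := step g _ lt; have := IHd (ltnW le_dn).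
  have -> : (n - d.+1).+1 = (n - d)%N by lia.
  lia.
pose B := (m * n)%N.
pose code (g : AV n.+1 m) : {ffun 'I_n.+1 -> 'I_(c + B + B).+1} :=
  [ffun i => inord (absz (val g i + B%:Z))].
have bd (g : AV n.+1 m) (i : 'I_n.+1) : SKV n.+1 m c k g ->
    0 <= val g i + B%:Z <= (c + B + B)%:Z.
  case=> A0 A1 _; have le_in : (i <= n)%N by rewrite -ltnS.
  have := A0 (inord 0); rewrite inordK // => /(_ erefl) g0.
  have := A1 (inord n); rewrite inordK // => /(_ ltac:(lia)) gn.
  have := up g i le_in; have := dn g (n - i)%N (leq_subr _ _).
  rewrite subKn // !inord_val.
  have : (m * i <= B)%N by rewrite leq_mul2l le_in orbT.
  have : (m * (n - i) <= B)%N by rewrite leq_mul2l leq_subr orbT.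
  lia.
have : finite_set (code @` SKV n.+1 m c k) by [].
suff inj : {in SKV n.+1 m c k &, injective code}.
  by rewrite (eq_finite_set (inj_card_eq inj)).
move=> g h /set_mem Sg /set_mem Sh /ffunP eq_gh.
apply: val_inj; apply/ffunP => i; have := eq_gh i.
rewrite !ffunE => /(congr1 val) /=.
have := bd g i Sg; have := bd h i Sh.
set a := val g i; set b := val h i => hb ha.
by rewrite !inordK; lia.
Qed.

(* Main.v *)
Require Import Defs.
From mathcomp Require Import all_boot all_order all_algebra.
From mathcomp Require Import all_classical all_reals.
From mathcomp Require Import finmap zify.

Set Implicit Arguments.
Unset Strict Implicit.

Import Order.TTheory GRing.Theory Num.Theory.
Local Open Scope ring_scope.

(* Unroll an area vector [g] to a map [G] from the integers with
   [G (i + n) = G i - c] and [G (i + 1) <= G i + m]. Moving the window of length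
   [n] by one step turns the first entry [a] into the last entry [a - c], which
   preserves the statistic because [F z = F (c - z)]. The window starting at [s]
   is k-skeletal exactly when [s] is the first position after the last run of
   [k + 1] consecutive entries [> c]; as [G] tends to [-oo] on the right and to
   [+oo] on the left, every [G] has exactly one such window. Hence, for each k,
   the k-skeletal vectors represent the maps [G] up to translation.
   To count the translation classes, note that each contains exactly [n] maps
   with [1 <= G 0 <= c], one for each residue of the translation modulo [n], and
   that such a map amounts to [G 0] and the [n] nonnegative numbers
   [G i + m - G (i + 1)] of sum [m n + c]. *)

(** * Periodic maps, unrolling and windows *)

Definition periodic_area (n m c : nat) (G : int -> int) : Prop :=
  (forall i, G (i + 1) <= G i + m%:Z) /\
  (forall i, G (i + n.+1%:Z) = G i - c%:Z).

(** With [i = r + n.+1 * q] and [0 <= r <= n], the rule for shifts by a period forces the value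
    [g r - c * q]. *)
Definition unroll (n c : nat) (g : {ffun 'I_n.+1 -> int}) (i : int) : int :=
  g (inord `|(i %% n.+1%:Z)%Z|) - c%:Z * (i %/ n.+1%:Z)%Z.

Definition window (n : nat) (G : int -> int) (s : int) :
  {ffun 'I_n.+1 -> int} := [ffun j : 'I_n.+1 => G (s + (j : nat)%:Z)].

Lemma divz_ord (n : nat) (i : int) :
  exists (q : int) (r : 'I_n.+1), i = (r : nat)%:Z + n.+1%:Z * q.
Proof.
have h0 : 0 <= (i %% n.+1%:Z)%Z by exact: modz_ge0.
have h1 : (i %% n.+1%:Z)%Z < n.+1%:Z by exact: ltz_pmod.
exists (i %/ n.+1%:Z)%Z, (inord `|(i %% n.+1%:Z)%Z|).
rewrite inordK; last by lia.
rewrite gez0_abs // [LHS](divz_eq i n.+1%:Z); lia.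
Qed.

Lemma unroll_ord (n c : nat) (g : {ffun 'I_n.+1 -> int}) (q : int)
    (r : 'I_n.+1) :
  unroll c g ((r : nat)%:Z + n.+1%:Z * q) = g r - c%:Z * q.
Proof.
have -> : (r : nat)%:Z + n.+1%:Z * q = q * n.+1%:Z + (r : nat)%:Z by lia.
rewrite /unroll modzMDl divzMDl //.
have hr : (r : nat)%:Z < `|n.+1%:Z| by have := ltn_ord r; lia.
rewrite divz_small ?addr0; last by rewrite hr andbT.
by rewrite modz_small ?absz_nat ?inord_val // hr andbT.
Qed.

Lemma unroll_nat (n c : nat) (g : {ffun 'I_n.+1 -> int}) (r : 'I_n.+1) :
  unroll c g (r : nat)%:Z = g r.
Proof. by have := unroll_ord c g 0 r; rewrite !mulr0 addr0 subr0. Qed.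

Lemma window_unroll (n c : nat) (g : {ffun 'I_n.+1 -> int}) :
  window n (unroll c g) 0 = g.
Proof. by apply/ffunP => j; rewrite ffunE add0r unroll_nat. Qed.

Lemma periodic_addM (n m c : nat) (G : int -> int) (i q : int) :
  periodic_area n m c G -> G (i + n.+1%:Z * q) = G i - c%:Z * q.
Proof.
case=> _ hG; elim: q => [|q IH|q IH]; first by rewrite !mulr0 addr0 subr0.
  have := hG (i + n.+1%:Z * q%:Z).
  have -> : i + n.+1%:Z * q%:Z + n.+1%:Z = i + n.+1%:Z * q.+1%:Z by lia.
  by move=> ->; rewrite IH; lia.
have := hG (i + n.+1%:Z * - q.+1%:Z).
have -> : i + n.+1%:Z * - q.+1%:Z + n.+1%:Z = i + n.+1%:Z * - q%:Z by lia.
by rewrite IH; lia.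
Qed.

Lemma unroll_window (n m c : nat) (G : int -> int) (s : int) :
  periodic_area n m c G -> unroll c (window n G s) = fun i => G (s + i).
Proof.
move=> hG; apply/funext => i; have [q [r ->]] := divz_ord n i.
by rewrite unroll_ord ffunE addrA (periodic_addM _ _ hG).
Qed.

Lemma periodic_shift (n m c : nat) (G : int -> int) (s : int) :
  periodic_area n m c G -> periodic_area n m c (fun i => G (s + i)).
Proof. by case=> h1 h2; split => i; rewrite addrA. Qed.

Lemma area_vector_window (n m c : nat) (G : int -> int) (s : int) :
  periodic_area n m c G -> is_area_vector m (window n G s).
Proof.
case=> hG _; apply/forallP => i; apply/forallP => j; apply/implyP => /eqP ij.
rewrite !ffunE ij; have := hG (s + (i : nat)%:Z); congr (G _ <= _); lia.
Qed.

(** Inside a period the steps are those of [g]; the second hypothesis is the step from the last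
    entry to [g ord0 - c], the first entry of the next period. *)
Lemma periodic_unroll (n m c : nat) (g : {ffun 'I_n.+1 -> int}) :
  is_area_vector m g -> g ord0 - c%:Z <= g ord_max + m%:Z ->
  periodic_area n m c (unroll c g).
Proof.
move=> hg wrap; split => i; have [q [r ->]] := divz_ord n i; last first.
  have -> : (r : nat)%:Z + n.+1%:Z * q + n.+1%:Z =
            (r : nat)%:Z + n.+1%:Z * (q + 1) by lia.
  by rewrite !unroll_ord; lia.
have [lt_rn|] := ltnP r n.
  have lt1 : (r.+1 < n.+1)%N by [].
  have /forallP/(_ r)/forallP/(_ (Ordinal lt1)) := hg.
  rewrite eqxx /= => step.
  have -> : (r : nat)%:Z + n.+1%:Z * q + 1 =
            (Ordinal lt1 : nat)%:Z + n.+1%:Z * q by rewrite /=; lia.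
  by rewrite !unroll_ord; lia.
move=> le_nr; have rE : r = ord_max.
  by apply/val_inj => /=; have := ltn_ord r; lia.
have -> : (r : nat)%:Z + n.+1%:Z * q + 1 =
          ((ord0 : 'I_n.+1) : nat)%:Z + n.+1%:Z * (q + 1) by rewrite rE /=; lia.
by rewrite !unroll_ord rE; lia.
Qed.

(** * Existence and uniqueness of the k-skeletal window *)

Lemma periodic_far (n m c : nat) (G : int -> int) : (0 < c)%N ->
  periodic_area n m c G ->
  exists B : nat, forall v : int,
    (B%:Z <= v -> G v <= 0) /\ (v <= - B%:Z -> c%:Z < G v).
Proof.
move=> c0 hG; pose M := \max_(r < n.+1) `|G (r : nat)%:Z|%N.
(* [M] bounds the absolute values on one period and each further period lowers [G] by [c >= 1], so
   [M + c + 1] periods suffice in both directions. *)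
exists (n.+1 * (M + c + 1))%N => v; have [q [r ->]] := divz_ord n v.
rewrite (periodic_addM _ _ hG).
have hM : (`|G (r : nat)%:Z| <= M)%N.
  exact: (leq_bigmax (F := fun r : 'I_n.+1 => `|G (r : nat)%:Z|%N)).
have := ltn_ord r; move: (G _) hM => a aM rn; split => h.
  have : M%:Z <= q by nia.
  nia.
have : q <= - (M + c + 1)%N%:Z by nia.
nia.
Qed.

(* [s] comes right after a run of [k + 1] entries [> c] (read off one period
   later, where they are the last entries [> 0] of the window at [s]), and no
   such run starts at [s] or later. *)
Definition skeletal_start (n c k : nat) (G : int -> int) (s : int) : Prop :=
  [/\ G s <= c%:Z,
      forall j : nat, (j <= k)%N -> 0 < G (s + n%:Z - j%:Z)
    & forall v : int, s <= v -> exists2 j : nat, (j <= k)%N & G (v + j%:Z) <= c%:Z].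

Lemma skeletal_start_shift (n c k : nat) (G : int -> int) (s t : int) :
  skeletal_start n c k (fun i => G (s + i)) t <->
  skeletal_start n c k G (s + t).
Proof.
split=> -[h0 h1 h2]; split => //.
- by move=> j /h1; congr (_ < G _); lia.
- move=> v le_v; have [|j jk] := h2 (v - s); first by lia.
  by move=> hj; exists j => //; move: hj; congr (G _ <= _); lia.
- by move=> j /h1; congr (_ < G _); lia.
- move=> v le_v; have [|j jk] := h2 (s + v); first by lia.
  by move=> hj; exists j => //; move: hj; congr (G _ <= _); lia.
Qed.

(** One period back, the second condition at [t] says that the [k + 1] entries just before [t]
    exceed [c]. If [s < t], this run starts at [s] or later, or it contains [s]; both contradict the
    conditions at [s]. *)
Lemma skeletal_start_unique (n m c k : nat) (G : int -> int) (s t : int) :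
  periodic_area n m c G -> skeletal_start n c k G s ->
  skeletal_start n c k G t -> s = t.
Proof.
move=> hG; wlog lt_st : s t / s < t.
  move=> wl hs ht; have [/wl|/wl wl'|//] := ltgtP s t; first exact.
  exact/esym/wl'.
case=> s0 s1 s2 [t0 t1 t2].
have big j : (j <= k)%N -> c%:Z < G (t - 1 - j%:Z).
  move=> /t1; have [_ per] := hG; have := per (t - 1 - j%:Z).
  have -> : t - 1 - j%:Z + n.+1%:Z = t + n%:Z - j%:Z by lia.
  by lia.
have [le_s|gt_s] := lerP s (t - 1 - k%:Z).
  have [j jk] := s2 _ le_s; have := big (k - j)%N (leq_subr _ _).
  have -> : t - 1 - (k - j)%N%:Z = t - 1 - k%:Z + j%:Z by lia.
  by lia.
have := big `|(t - 1 - s)%R|%N ltac:(lia).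
have -> : t - 1 - `|(t - 1 - s)%R|%N%:Z = s by lia.
by lia.
Qed.

Lemma skeletal_start_exists (n m c k : nat) (G : int -> int) : (0 < c)%N ->
  periodic_area n m c G -> exists s, skeletal_start n c k G s.
Proof.
move=> c0 hG; have [B hB] := periodic_far c0 hG.
(* The offset [B + k] makes the run for [t = 0] end at [- B], so that the last run can be sought
   among natural numbers. *)
pose run (t : nat) :=
  [forall j : 'I_k.+1, c%:Z < G (t%:Z - (B + k)%N%:Z + (j : nat)%:Z)].
have run0 : exists t, run t.
  exists 0%N; apply/forallP => j; have := ltn_ord j => lt_j.
  by have [_] := hB (0%:Z - (B + k)%N%:Z + (j : nat)%:Z); apply; lia.
have run_le t : run t -> (t <= B + B + k)%N.
  move=> /forallP/(_ ord0) /=; rewrite addr0 => gtc.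
  by have [+ _] := hB (t%:Z - (B + k)%N%:Z); lia.
have [t ht maxt] := ex_maxnP run0 run_le.
have big j : (j <= k)%N -> c%:Z < G (t%:Z - (B + k)%N%:Z + j%:Z).
  by rewrite -ltnS => lt_j; have /forallP/(_ (Ordinal lt_j)) := ht.
exists (t%:Z - B%:Z + 1); split.
(* Otherwise the last run could be moved one place to the right. *)
- rewrite leNgt; apply/negP => gtc; suff /maxt : run t.+1 by rewrite ltnn.
  apply/forallP => -[j /= lt_j]; have [ltjk|gejk] := ltnP j k.
    by have := big j.+1 ltjk; congr (_ < G _); lia.
  by move: gtc; congr (_ < G _); lia.
- move=> j jk; have := big (k - j)%N (leq_subr _ _); have [_ per] := hG.
  have := per (t%:Z - (B + k)%N%:Z + (k - j)%N%:Z).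
  have -> : t%:Z - (B + k)%N%:Z + (k - j)%N%:Z + n.+1%:Z
            = t%:Z - B%:Z + 1 + n%:Z - j%:Z by lia.
  by lia.
- move=> v le_v; pose t' := `|(v + (B + k)%N%:Z)%R|%N.
  have : ~~ run t' by apply/negP => /maxt; lia.
  rewrite negb_forall => /existsP[j]; rewrite -leNgt => hj.
  exists j; first by rewrite -ltnS.
  by move: hj; congr (G _ <= _); lia.
Qed.

(** (A2) only sees runs inside the window, so runs that start or end beyond it have to be excluded
    by periodicity. *)
Lemma skeletal_startP (n m c k : nat) (g : AV n.+1 m) : (k < n.+1)%N ->
  periodic_area n m c (unroll c (val g)) ->
  skeletal c k g <-> skeletal_start n c k (unroll c (val g)) 0.
Proof.
move=> lt_kn; have Gg (i : 'I_n.+1) : val g i = unroll c (val g) (i : nat)%:Z.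
  by rewrite unroll_nat.
move: (unroll c _) Gg => G Gg hG.
have Gnat (i : nat) : (i <= n)%N -> val g (inord i) = G i%:Z.
  by move=> le_i; rewrite Gg inordK.
split=> -[h0 h1 h2]; split.
- by have := h0 ord0 erefl; rewrite Gg.
- move=> j jk; have := h1 (inord (n - j)); rewrite Gnat; last by lia.
  rewrite inordK; last by lia.
  move=> /(_ ltac:(lia)); congr (_ < G _); lia.
- move=> v v0; apply: contrapT => no.
  have big j : (j <= k)%N -> c%:Z < G (v + j%:Z).
    by move=> jk; rewrite ltNge; apply/negP => hj; apply: no; exists j.
  have [q [r vE]] := divz_ord n v.
  have q0 : 0 <= q by have := ltn_ord r; nia.
  (* Moving back by [q >= 0] periods does not lower the values, so the run may start inside the
     window. *)
  have big' j : (j <= k)%N -> c%:Z < G ((r : nat)%:Z + j%:Z).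
    move=> /big; rewrite vE addrAC (periodic_addM _ _ hG) => /lt_le_trans; apply.
    by rewrite gerBl mulr_ge0.
  (* A run leaving the window would contain position [n.+1], where the value is [G 0 - c <= 0]. *)
  have le_rk : (r + k <= n)%N.
    rewrite leqNgt; apply/negP => gt.
    have := big' (n.+1 - r)%N ltac:(lia).
    have -> : (r : nat)%:Z + (n.+1 - r)%N%:Z = 0 + n.+1%:Z.
      by have := ltn_ord r; lia.
    have G0 : G 0 <= c%:Z by have := h0 ord0 erefl; rewrite Gg.
    by have [_ ->] := hG; lia.
  apply: h2; exists r; first by lia.
  move=> j /andP[rj jk]; rewrite Gg; have := big' (j - r)%N ltac:(lia).
  by congr (_ < G _); lia.
- by move=> i i0; rewrite Gg i0.
- move=> i le_i; rewrite Gg; have lt_i := ltn_ord i.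
  by have := h1 (n - i)%N ltac:(lia); congr (_ < G _); lia.
- case=> i le_i big; have [//|j jk] := h2 (i : nat)%:Z.
  have := big (inord (i + j)); rewrite Gnat; last by lia.
  rewrite inordK; last by lia.
  move=> /(_ ltac:(lia)).
  have -> : (i + j)%N%:Z = (i : nat)%:Z + j%:Z by lia.
  by lia.
Qed.

(** By (A0) the next period begins with a value [<= 0], and by (A1) the last entry is positive, so
    the wrap-around step is allowed. *)
Lemma skeletal_periodic (n m c k : nat) (g : AV n.+1 m) :
  skeletal c k g -> periodic_area n m c (unroll c (val g)).
Proof.
case=> h0 h1 _; apply: periodic_unroll; first exact: (valP g).
apply: (@le_trans _ _ 0); first by rewrite subr_le0; exact: h0.
by rewrite addr_ge0 // ltW // h1 //= -subnDA leq_subLR; lia.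
Qed.

(** * Invariance of the statistic under moving the window *)

Definition pair_sum (V : nmodType) (F : int -> V) (n : nat)
    (g : {ffun 'I_n -> int}) : V :=
  \sum_(i < n) \sum_(j < n | (i < j)%N) F (g i - g j).

(** Applied to the window at [s], with [sum_triangle_recr] applied to the one at [s + 1]: once the
    outgoing and the incoming entry are split off, the same triangle remains. *)
Lemma sum_triangle_recl (V : nmodType) (n : nat) (f : nat -> nat -> V) :
  \sum_(i < n.+1) \sum_(j < n.+1 | (i < j)%N) f i j =
  \sum_(j < n) f 0%N j.+1 + \sum_(i < n) \sum_(j < n | (i < j)%N) f i.+1 j.+1.
Proof.
rewrite big_ord_recl; congr (_ + _).
  by rewrite big_mkcond big_ord_recl /= add0r.
apply: eq_bigr => i _; rewrite big_mkcond big_ord_recl /= add0r.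
by rewrite [RHS]big_mkcond.
Qed.

Lemma sum_triangle_recr (V : nmodType) (n : nat) (f : nat -> nat -> V) :
  \sum_(i < n.+1) \sum_(j < n.+1 | (i < j)%N) f i j =
  \sum_(i < n) f i n + \sum_(i < n) \sum_(j < n | (i < j)%N) f i j.
Proof.
rewrite big_ord_recr /= [X in _ + X]big1 ?addr0; last first.
  by move=> j; have := ltn_ord j; lia.
rewrite addrC -big_split /=; apply: eq_bigr => i _.
rewrite big_mkcond big_ord_recr /= ltn_ord; congr (_ + _).
by rewrite [RHS]big_mkcond.
Qed.

(* Passing from the window at [s] to the one at [s + 1] replaces the first entry
   [a] by the last entry [a - c], and [F (a - b) = F (b - (a - c))]. *)
Lemma pair_sum_windowS (V : nmodType) (F : int -> V) (n m c : nat)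
    (G : int -> int) (s : int) :
  (forall z, F z = F (c%:Z - z)) -> periodic_area n m c G ->
  pair_sum F (window n G (s + 1)) = pair_sum F (window n G s).
Proof.
move=> hF [_ per]; rewrite /pair_sum.
pose f (i j : nat) := F (G (s + i%:Z) - G (s + j%:Z)).
transitivity (\sum_(i < n.+1) \sum_(j < n.+1 | (i < j)%N) f i.+1 j.+1).
  apply: eq_bigr => i _; apply: eq_bigr => j _; rewrite !ffunE /f.
  by congr (F (G _ - G _)); lia.
transitivity (\sum_(i < n.+1) \sum_(j < n.+1 | (i < j)%N) f i j); last first.
  by apply: eq_bigr => i _; apply: eq_bigr => j _; rewrite !ffunE.
rewrite (sum_triangle_recl _ f) (sum_triangle_recr _ (fun i j => f i.+1 j.+1)).
congr (_ + _); apply: eq_bigr => i _; rewrite /f hF addr0 per.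
by congr F; lia.
Qed.

Lemma pair_sum_window (V : nmodType) (F : int -> V) (n m c : nat)
    (G : int -> int) (s : int) :
  (forall z, F z = F (c%:Z - z)) -> periodic_area n m c G ->
  pair_sum F (window n G s) = pair_sum F (window n G 0).
Proof.
move=> hF hG; elim: s => [//|s IH|s IH].
  rewrite -IH -(pair_sum_windowS s%:Z hF hG).
  by congr (pair_sum F (window n G _)); lia.
rewrite -IH -(pair_sum_windowS (- s.+1%:Z) hF hG).
by congr (pair_sum F (window n G _)); lia.
Qed.

(** * Bijections between the skeletal sets for different k *)

Lemma skeletal_windowP (n m c k : nat) (G : int -> int) (s : int)
    (g : AV n.+1 m) : (k < n.+1)%N ->
  periodic_area n m c G -> val g = window n G s ->
  skeletal c k g <-> skeletal_start n c k G s.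
Proof.
move=> lt_kn hG gE; have uE := unroll_window s hG; rewrite -gE in uE.
rewrite skeletal_startP // uE; last exact: periodic_shift.
by rewrite skeletal_start_shift addr0.
Qed.

(** By [skeletal_start_exists], the default [0] is never taken for a periodic [G] with [0 < c]. *)
Definition start (n c k : nat) (G : int -> int) : int :=
  xget 0 [set s | skeletal_start n c k G s]%classic.

Lemma startP (n m c k : nat) (G : int -> int) : (0 < c)%N ->
  periodic_area n m c G -> skeletal_start n c k G (start n c k G).
Proof.
move=> c0 hG; have [s hs] := skeletal_start_exists k c0 hG.
by apply: (@xgetPex _ 0 [set s | skeletal_start n c k G s]%classic); exists s.
Qed.

Lemma start_eq (n m c k : nat) (G : int -> int) (s : int) :
  periodic_area n m c G -> skeletal_start n c k G s -> start n c k G = s.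
Proof.
move=> hG hs.
have := @xgetPex _ 0 [set s | skeletal_start n c k G s]%classic (ex_intro _ s hs).
by move/(skeletal_start_unique hG); apply.
Qed.

(** The default [g] of [insubd] makes the map total; for skeletal [g] the unrolled map is periodic
    and its windows are area vectors. *)
Definition rewindow (n m c k : nat) (g : AV n.+1 m) : AV n.+1 m :=
  insubd g (window n (unroll c (val g)) (start n c k (unroll c (val g)))).

Lemma val_rewindow (n m c k : nat) (g : AV n.+1 m) :
  periodic_area n m c (unroll c (val g)) ->
  val (rewindow c k g) =
  window n (unroll c (val g)) (start n c k (unroll c (val g))).
Proof. by move=> hg; rewrite val_insubd (area_vector_window _ hg). Qed.

Lemma skeletal_rewindow (n m c k : nat) (g : AV n.+1 m) :
  (0 < c)%N -> (k < n.+1)%N -> periodic_area n m c (unroll c (val g)) ->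
  skeletal c k (rewindow c k g).
Proof.
move=> c0 lt_kn hg; rewrite (skeletal_windowP lt_kn hg (val_rewindow k hg)).
exact: startP hg.
Qed.

Lemma rewindowK (n m c k l : nat) (g : AV n.+1 m) :
  (0 < c)%N -> (k < n.+1)%N -> (l < n.+1)%N -> skeletal c k g ->
  rewindow c k (rewindow c l g) = g.
Proof.
move=> c0 lt_kn lt_ln sg; have hg := skeletal_periodic sg.
have uE : unroll c (val (rewindow c l g)) =
    fun i => unroll c (val g) (start n c l (unroll c (val g)) + i).
  by rewrite val_rewindow // (unroll_window _ hg).
set t := start n c l _ in uE.
have hu : periodic_area n m c (unroll c (val (rewindow c l g))).
  by rewrite uE; exact: periodic_shift.
apply: val_inj; rewrite val_rewindow //.
(* Unrolling the new window translates the map by [t], so the old window, which starts at [0], is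
   found at [- t]. *)
have -> : start n c k (unroll c (val (rewindow c l g))) = - t.
  apply: (start_eq hu); rewrite uE skeletal_start_shift subrr.
  exact/skeletal_startP.
rewrite -[RHS](window_unroll c); apply/ffunP => j; rewrite !ffunE uE.
by congr unroll; lia.
Qed.

Lemma rewindow_bij (n m c k l : nat) :
  (0 < c)%N -> (k < n.+1)%N -> (l < n.+1)%N ->
  set_bij (SKV n.+1 m c k) (SKV n.+1 m c l) (rewindow c l).
Proof.
move=> c0 lt_kn lt_ln; split.
- by move=> g sg; apply: skeletal_rewindow => //; exact: skeletal_periodic sg.
- move=> g h /set_mem sg /set_mem sh eq_gh.
  by rewrite -(rewindowK c0 lt_kn lt_ln sg) eq_gh rewindowK.
- move=> g sg; exists (rewindow c k g); last exact: rewindowK.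
  by apply: skeletal_rewindow => //; exact: skeletal_periodic sg.
Qed.

(** [stat] is only assumed to factor through the pair sum, so that [F] may take its values in any
    [V], such as the reals. *)
Lemma SKV_poly_eq (V : nmodType) (F : int -> V) (n m c k l : nat)
    (stat : AV n.+1 m -> nat) :
  (0 < c)%N -> (forall z, F z = F (c%:Z - z)) ->
  (forall g h, pair_sum F (val g) = pair_sum F (val h) -> stat g = stat h) ->
  (k < n.+1)%N -> (l < n.+1)%N -> SKV_poly c k stat = SKV_poly c l stat.
Proof.
move=> c0 hF hstat lt_kn lt_ln; rewrite /SKV_poly.
rewrite (reindex_fsbig _ _ _ _ (rewindow_bij m c0 lt_kn lt_ln)).
apply: eq_fsbigr => g /set_mem sg; congr ('X^_); apply: hstat.
have hg := skeletal_periodic sg.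
by rewrite val_rewindow // (pair_sum_window _ hF hg) window_unroll.
Qed.

(** * Periodic maps encoded by one value and their drops *)

Lemma periodic_inj (n m c : nat) (G H : int -> int) :
  periodic_area n m c G -> periodic_area n m c H ->
  (forall i : nat, (i <= n)%N -> G i%:Z = H i%:Z) -> G = H.
Proof.
move=> hG hH GH; apply/funext => i; have [q [r ->]] := divz_ord n i.
by rewrite (periodic_addM _ _ hG) (periodic_addM _ _ hH) GH // -ltnS.
Qed.

(** Bounded ordinals make these tuples a finite type, to be counted by [card_ord_partitions]; [M]
    will be the sum of the drops. *)
Definition steps (n m M : nat) (G : int -> int) : n.+1.-tuple 'I_M.+1 :=
  [tuple inord `|(G (i : nat)%:Z + m%:Z - G ((i : nat)%:Z + 1))%R|%N | i < n.+1].

Lemma sum_drops (n m c : nat) (G : int -> int) : periodic_area n m c G ->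
  \sum_(i < n.+1) (G (i : nat)%:Z + m%:Z - G ((i : nat)%:Z + 1)) =
  (m * n.+1 + c)%N%:Z.
Proof.
case=> _ per.
rewrite -(big_mkord xpredT (fun i => G i%:Z + m%:Z - G (i%:Z + 1))).
rewrite (telescope_sumr_eq (fun i : nat => m%:Z * i%:Z - G i%:Z)) //.
  have -> : G n.+1%:Z = G 0%:Z - c%:Z by exact: (per 0).
  by lia.
move=> i _; have -> : G i.+1%:Z = G (i%:Z + 1) by congr G; lia.
move: (G (_ + 1)) (G _) => x y; lia.
Qed.

(** The drops are nonnegative, hence at most their sum, so neither the absolute value nor [inord]
    changes them. *)
Lemma tnth_steps (n m c : nat) (G : int -> int) (i : 'I_n.+1) :
  periodic_area n m c G ->
  (tnth (steps n m (m * n.+1 + c) G) i : nat)%:Z =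
  G (i : nat)%:Z + m%:Z - G ((i : nat)%:Z + 1).
Proof.
move=> hG; have [st _] := hG; have drop_ge0 (j : int) : 0 <= G j + m%:Z - G (j + 1).
  by rewrite subr_ge0.
have le_drop : G (i : nat)%:Z + m%:Z - G ((i : nat)%:Z + 1) <= (m * n.+1 + c)%N%:Z.
  rewrite -(sum_drops hG) (bigD1 i) //= lerDl; exact: sumr_ge0.
rewrite tnth_mktuple; have := drop_ge0 (i : nat)%:Z.
move: (_ - _) le_drop => d le_d d_ge0; rewrite inordK; lia.
Qed.

Lemma sum_steps (n m c : nat) (G : int -> int) : periodic_area n m c G ->
  (\sum_(d <- steps n m (m * n.+1 + c) G) (d : nat))%N = (m * n.+1 + c)%N.
Proof.
move=> hG; apply/eqP; rewrite -eqz_nat -(sum_drops hG) big_tuple; apply/eqP.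
rewrite -[LHS]natz natr_sum; apply: eq_bigr => i _.
by rewrite natz (tnth_steps i hG).
Qed.

Lemma steps_inj (n m c : nat) (G H : int -> int) :
  periodic_area n m c G -> periodic_area n m c H -> G 0 = H 0 ->
  steps n m (m * n.+1 + c) G = steps n m (m * n.+1 + c) H -> G = H.
Proof.
move=> hG hH GH0 eq_st; apply: (periodic_inj hG hH).
elim=> [//|i IH] lt_in; have /= := tnth_steps (Ordinal (ltnW lt_in : i < n.+1)%N) hG.
rewrite eq_st (tnth_steps _ hH) /= IH ?(ltnW lt_in) //.
have -> : i.+1%:Z = i%:Z + 1 :> int by lia.
move: (G _) (H _) (H _); lia.
Qed.

Lemma steps_surj (n m c : nat) (a : int)
    (t : n.+1.-tuple 'I_(m * n.+1 + c).+1) :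
  (\sum_(d <- t) (d : nat))%N = (m * n.+1 + c)%N ->
  exists G, [/\ periodic_area n m c G, G 0 = a & steps n m (m * n.+1 + c) G = t].
Proof.
move=> sum_t.
have [H [H0 HS HN]] : exists H : nat -> int, [/\ H 0%N = a,
    forall i, H i.+1 = H i + m%:Z - (nth ord0 t i : nat)%:Z
  & H n.+1 = H 0%N - c%:Z].
  (* Partial sums invert the drops, and the prescribed total gives the descent [c] over a period. *)
  exists (fun i => a + m%:Z * i%:Z - \sum_(0 <= j < i) (nth ord0 t j : nat)%:Z).
  split => [|i|]; first by rewrite big_geq // mulr0 addr0 subr0.
    by rewrite big_nat_recr //=; move: (\sum_(_ <= _ < _) _) => S; lia.
  have -> : \sum_(0 <= j < n.+1) (nth ord0 t j : nat)%:Z = (m * n.+1 + c)%N%:Z :> int.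
    apply: etrans (congr1 Posz sum_t); rewrite -[RHS]natz (big_nth ord0) size_tuple natr_sum.
    by apply: eq_bigr => j _; rewrite natz.
  by rewrite big_geq //; lia.
pose g : {ffun 'I_n.+1 -> int} := [ffun i : 'I_n.+1 => H i].
have hG : periodic_area n m c (unroll c g).
  apply: periodic_unroll.
    apply/forallP => i; apply/forallP => j; apply/implyP => /eqP ij.
    by rewrite !ffunE ij HS; lia.
  by rewrite !ffunE /=; have := HS n; rewrite HN; lia.
(* The range includes [n.+1] because the last drop reads the first entry of the next period. *)
have GH (i : nat) : (i <= n.+1)%N -> unroll c g i%:Z = H i.
  rewrite leq_eqVlt => /orP[/eqP ->|lt_i]; last first.
    by rewrite (unroll_nat c g (Ordinal lt_i)) ffunE.
  have [_ per] := hG; have := per 0; rewrite add0r => ->.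
  by rewrite (unroll_nat c g ord0) ffunE HN.
exists (unroll c g); split => //; first by rewrite GH.
apply: eq_from_tnth => i; apply/val_inj/eqP; rewrite -eqz_nat.
rewrite (tnth_steps i hG) GH; last exact/ltnW/ltn_ord.
have -> : (i : nat)%:Z + 1 = i.+1%:Z :> int by lia.
by rewrite GH ?ltn_ord // HS (tnth_nth ord0) opprB addrC subrK.
Qed.

(* The only index congruent to [s] modulo [n + 1] at which [G] has its value in
   [1 .. c]. *)
Definition base (n c : nat) (G : int -> int) (s : 'I_n.+1) : int :=
  (s : nat)%:Z + n.+1%:Z * ((G (s : nat)%:Z - 1) %/ c%:Z)%Z.

Lemma base_bounds (n m c : nat) (G : int -> int) (s : 'I_n.+1) : (0 < c)%N ->
  periodic_area n m c G -> 1 <= G (base c G s) <= c%:Z.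
Proof.
move=> c0 hG; rewrite (periodic_addM _ _ hG).
have := divz_eq (G (s : nat)%:Z - 1) c%:Z.
have : 0 <= ((G (s : nat)%:Z - 1) %% c%:Z)%Z by apply: modz_ge0; lia.
have : ((G (s : nat)%:Z - 1) %% c%:Z)%Z < c%:Z by apply: ltz_pmod.
lia.
Qed.

Lemma base_unique (n m c : nat) (G : int -> int) (t : int) :
  periodic_area n m c G -> 1 <= G t <= c%:Z -> exists s : 'I_n.+1, base c G s = t.
Proof.
move=> hG; have [q [s ->]] := divz_ord n t.
rewrite (periodic_addM _ _ hG) => bd; exists s; rewrite /base; congr (_ + _ * _).
have -> : G (s : nat)%:Z - 1 = q * c%:Z + (G (s : nat)%:Z - c%:Z * q - 1) by lia.
have c0 : c%:Z != 0 by lia.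
rewrite divzMDl // divz_small ?addr0 //; lia.
Qed.

Lemma base_inj (n c : nat) (G : int -> int) : injective (@base n c G).
Proof.
move=> s t; rewrite /base => /(congr1 (fun x => (x %% n.+1%:Z)%Z)).
rewrite ![_ + n.+1%:Z * _]addrC ![n.+1%:Z * _]mulrC !modzMDl.
have lt_s := ltn_ord s; have lt_t := ltn_ord t.
rewrite !modz_small; [|lia|lia].
by case=> /val_inj.
Qed.

(** * Double counting of pairs of a skeletal vector and a residue *)

Definition encode (n m c : nat) (x : AV n.+1 m * 'I_n.+1) :
    n.+1.-tuple 'I_(m * n.+1 + c.+1).+1 * 'I_c.+1 :=
  let G := unroll c.+1 (val x.1) in
  let H := fun i => G (base c.+1 G x.2 + i) in
  (steps n m (m * n.+1 + c.+1) H, inord `|(H 0 - 1)%R|).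

(** The code determines the translated map, whose unique k-skeletal start is minus the base. Hence
    the bases agree, then the maps, then the vectors as windows at [0], and finally the residues. *)
Lemma encode_inj (n m c k : nat) (x y : AV n.+1 m * 'I_n.+1) : (k < n.+1)%N ->
  skeletal c.+1 k x.1 -> skeletal c.+1 k y.1 -> encode c x = encode c y -> x = y.
Proof.
case: x y => [g s] [h t] lt_kn sg sh enc; rewrite /= in sg sh.
have hg := skeletal_periodic sg; have hh := skeletal_periodic sh.
have /(skeletal_startP lt_kn hg) Sg := sg.
have /(skeletal_startP lt_kn hh) Sh := sh.
have gE := window_unroll c.+1 (val g); have hE := window_unroll c.+1 (val h).
have := congr1 (fun y => val y.2) enc; have := congr1 fst enc.
rewrite /encode [fst _]/= [fst _]/= [snd _]/= [snd _]/=.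
move: (unroll _ (val g)) (unroll _ (val h)) hg hh Sg Sh gE hE => G H.
move=> hG hH Sg Sh gE hE eq_st; rewrite !addr0.
have := base_bounds s (ltn0Sn c) hG; have := base_bounds t (ltn0Sn c) hH => bdt bds.
rewrite /= !inordK; [|lia|lia] => eq_a.
have eqG : (fun i => G (base c.+1 G s + i)) = (fun i => H (base c.+1 H t + i)).
  apply: (steps_inj _ _ _ eq_st); try exact: periodic_shift.
  by rewrite !addr0; lia.
have eq_base : base c.+1 G s = base c.+1 H t.
  apply: oppr_inj.
  apply: (skeletal_start_unique (k := k) (periodic_shift (base c.+1 G s) hG)).
    by rewrite skeletal_start_shift subrr.
  by rewrite eqG skeletal_start_shift subrr.
have GH : G = H.
  apply/funext => i; have := congr1 (fun f => f (i - base c.+1 G s)) eqG => /=.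
  by rewrite -eq_base addrC subrK.
have gh : g = h by apply: val_inj; rewrite -gE -hE GH.
have st : s = t by apply: (@base_inj n c.+1 G); rewrite eq_base GH.
by rewrite -gh st.
Qed.

Lemma encode_surj (n m c k : nat)
    (y : n.+1.-tuple 'I_(m * n.+1 + c.+1).+1 * 'I_c.+1) : (k < n.+1)%N ->
  (\sum_(d <- y.1) (d : nat))%N = (m * n.+1 + c.+1)%N ->
  exists2 x : AV n.+1 m * 'I_n.+1, skeletal c.+1 k x.1 & encode c x = y.
Proof.
case: y => [t a] lt_kn /= sum_t.
have [G [hG G0 <-]] := steps_surj ((a : nat)%:Z + 1) sum_t.
have [s hs] := skeletal_start_exists k (ltn0Sn c) hG.
pose g : AV n.+1 m :=
  exist (fun h => is_true (is_area_vector m h)) _ (area_vector_window s hG).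
have gE : val g = window n G s by [].
have uE : unroll c.+1 (val g) = fun i => G (s + i) by rewrite gE (unroll_window s hG).
have hg := periodic_shift s hG; have lt_a := ltn_ord a.
(* After cutting at [s], position [0] of [G] gets index [- s]; its value [a + 1] lies in
   [1 .. c.+1], so this index is the base of some residue. *)
have [|r rE] := base_unique (t := - s) hg; first by rewrite subrr G0; lia.
exists (g, r); first by rewrite (skeletal_windowP lt_kn hG gE).
rewrite /encode /= uE rE; congr (steps _ _ _ _, _).
  by apply/funext => i; congr G; lia.
rewrite addr0 subrr G0; apply: val_inj => /=; rewrite inordK; lia.
Qed.

(** [encode] matches the pairs on the left with the pairs of a tuple of prescribed sum and a value.
    With [c.+1] for the bound, ['I_c.+1] is exactly the range [1 .. c.+1] lowered by one. *)
Lemma card_SKV (n m c k : nat) : (k < n.+1)%N ->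
  (#|` fset_set (SKV n.+1 m c.+1 k)| * n.+1 =
   'C(n + (m * n.+1 + c.+1), n) * c.+1)%N.
Proof.
move=> lt_kn; pose S := fset_set (SKV n.+1 m c.+1 k).
have memS g : (g \in S) = (g \in SKV n.+1 m c.+1 k).
  by rewrite in_fset_set //; exact: SKV_finite.
have skS (z : S) : skeletal c.+1 k (val z).
  by apply/set_mem; rewrite -memS; exact: valP.
pose f (x : S * 'I_n.+1) := encode c (val x.1, x.2).
have f_inj : injective f.
  move=> [x s] [y t] /(encode_inj lt_kn)/= xy.
  by case: (xy (skS x) (skS y)) => /val_inj -> ->.
have -> : (#|` S| * n.+1 = #|[set f x | x in predT]|)%N.
  by rewrite (card_imset _ f_inj) card_prod card_ord cardfE.
(* Stars and bars counts the tuples of drops. *)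
rewrite -[X in _ = (_ * X)%N]card_ord -card_ord_partitions -cardsT -cardsX.
apply: eq_card => y; rewrite !inE andbT; apply/imsetP/eqP.
  case=> x _ ->; apply: sum_steps; apply: periodic_shift.
  exact: (skeletal_periodic (skS x.1)).
move=> /(encode_surj lt_kn)[[g s] sg yE].
have gS : g \in S by rewrite memS; apply/mem_set.
by exists ([` gS]%fset, s).
Qed.

(** * Evaluation at one and the closed formula *)

Lemma horner_SKV_poly (n m c k : nat) (stat : AV n m -> nat) :
  (SKV_poly c k stat).[1] = #|` fset_set (SKV n m c k)|%:Z.
Proof.
rewrite /SKV_poly fsbig_finite; last exact: SKV_finite.
rewrite horner_sum card_fset_sum1 -[RHS]natz natr_sum.
by apply: eq_bigr => g _; rewrite hornerXn expr1n.
Qed.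

Theorem theorem5p1 (R : realType) (n m c : nat)
    (hn : (0 < n)%N) (hm : (0 < m)%N) (hc : (0 < c)%N)
    (F : R -> R) (hF : forall z : R, F z = F (c%:R - z))
    (stat : AV n m -> nat)
    (hstat : forall g : AV n m,
       (stat g)%:R =
         \sum_(i < n) \sum_(j < n | (i < j)%N) F ((val g i - val g j)%:~R))
    (k : nat) (hk : (k < n)%N) :
  SKV_poly c k stat = SKV_poly c (n - 1) stat /\
  ((SKV_poly c k stat).[1])%:~R =
    c%:R / ((m + 1) * n + c)%:R * 'C((m + 1) * n + c, n)%:R :> rat.
Proof.
case: n hn stat hstat hk => // n _ stat hstat lt_kn; split.
  apply: (@SKV_poly_eq _ (fun z : int => F z%:~R)) => //; last by lia.
    by move=> z; rewrite hF intrB.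
  move=> g h eq_gh; apply/eqP; rewrite -(eqr_nat R) !hstat; exact/eqP.
rewrite horner_SKV_poly; case: c hc {hF} => // c _.
have := card_SKV m c lt_kn; set s := #|` _|.
set M := (m * n.+1 + c.+1)%N => hs.
have -> : ((m + 1) * n.+1 + c.+1 = (n + M).+1)%N by rewrite /M; lia.
(* The absorption identity for binomials lets the factor [n.+1] of the double count be cancelled. *)
have hb := mul_bin_diag (n + M).+1 n; rewrite /= in hb.
have : ((n + M).+1 * s = c.+1 * 'C((n + M).+1, n.+1))%N.
  apply/eqP; rewrite -(eqn_pmul2r (ltn0Sn n)); apply/eqP.
  by rewrite -mulnA hs mulnA hb; lia.
move/(congr1 (fun x : nat => x%:R : rat)); rewrite !natrM => e.
have ne : (n + M).+1%:R != 0 :> rat by rewrite pnatr_eq0.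
by rewrite mulrAC -e mulrAC divff // mul1r -pmulrn.
Qed.
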